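(* Let $\alpha,\beta\ge 1$ be odd integers and let $n_\alpha,n_\beta\ge 1$ be integers. Let $A_s=\{a_{(i,s)}\}_{i=1}^{\alpha}$ for $s=1,\dots,n_\alpha$ and $B_t=\{b_{(j,t)}\}_{j=1}^{\beta}$ for $t=1,\dots,n_\beta$ be pairwise disjoint sets of elementary regions which together make up all regions of a pure state (one of the regions being the purifier). For indices $i_s\in\{1,\dots,\alpha\}$ and $j_t\in\{1,\dots,\beta\}$ write $a^{\pm}_{i_s}:=a^{\pm}_{(i_s,s)}$ and $b^{\pm}_{j_t}:=b^{\pm}_{(j_t,t)}$. Then the inequality $$\sum_{i_1,\dots,i_{n_\alpha}=1}^{\alpha}\ \sum_{j_1,\dots,j_{n_\beta}=1}^{\beta} S_{a^+_{i_1}\cdots a^+_{i_{n_\alpha}}b^-_{j_1}\cdots b^-_{j_{n_\beta}}}\ \ge\ \sum_{i_1,\dots,i_{n_\alpha}=1}^{\alpha}\ \sum_{j_1,\dots,j_{n_\beta}=1}^{\beta} S_{a^-_{i_1}\cdots a^-_{i_{n_\alpha}}b^-_{j_1}\cdots b^-_{j_{n_\beta}}}\ +\ \alpha^{n_\alpha-1}\beta^{n_\beta-1}\,S_{A_1\cdots A_{n_\alpha}}$$ is a holographic entropy inequality, and it is redundant, being implied by the $(\alpha;\beta)$-toric inequalities: it can be expressed as a sum of instances of the $(\alpha;\beta)$-toric inequality.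
   Context: Regions and notation. There are finitely many pairwise disjoint elementary (monochromatic) regions, including a purifier, whose joint state is pure. For a union (set) $\omega$ of elementary regions, $S_\omega$ denotes its entropy; juxtaposition in a subscript means union, $S_\emptyset=0$, and purity means $S_\omega=S_{\bar\omega}$ where $\bar\omega$ is the complementary set of regions. $S_{A_1\cdots A_{n_\alpha}}$ is the entropy of the union of all regions in $A_1,\dots,A_{n_\alpha}$. Cyclic blocks. For a cyclically ordered list $a_1,\dots,a_\alpha$ of an odd number $\alpha$ of regions, with indices read modulo $\alpha$, put $a_i^{(k)}:=a_i a_{i+1}\cdots a_{i+k-1}$ (union of $k$ cyclically consecutive regions) and $a_i^{\pm}:=a_i^{((\alpha\pm1)/2)}$. Similarly $b_j^{\pm}:=b_j^{((\beta\pm1)/2)}$ for a list $b_1,\dots,b_\beta$ with $\beta$ odd and indices modulo $\beta$. The same definition is applied to each list $A_s$ (indices modulo $\alpha$) and each list $B_t$ (indices modulo $\beta$), giving $a^{\pm}_{(i,s)}$ and $b^{\pm}_{(j,t)}$. A block of length $0$ is empty. Holographic entropy inequality (HEI). A linear inequality $\sum_u c_u S_{L_u}\ge\sum_v d_v S_{R_v}$ (with $c_u,d_v>0$) is an HEI if it holds whenever the entropies are holographic, i.e. given by the Ryu–Takayanagi formula $S_\omega=\mathrm{area}(\mathcal X_\omega)/4G_N$, where $\mathcal X_\omega$ is a minimal-area bulk surface homologous to the boundary region $\omega$. In the standard equivalent graph model: take a finite undirected graph with vertex set $V$ and nonnegative edge weights, together with a set $\partial V\subseteq V$ of boundary vertices,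 each coloured by one of the elementary regions (purifier included); then $S_\omega$ is the minimum, over all $W\subseteq V$ such that $W\cap\partial V$ is exactly the set of boundary vertices coloured by a region in $\omega$, of the total weight of edges between $W$ and $V\setminus W$. An inequality is an HEI if it holds for all such graphs. $(\alpha;\beta)$-toric inequality. For $\alpha,\beta$ odd, given disjoint regions $a_1,\dots,a_\alpha,b_1,\dots,b_\beta$ whose joint state is pure, it is $$\sum_{i=1}^{\alpha}\sum_{j=1}^{\beta}S_{a_i^+b_j^-}\ \ge\ \sum_{i=1}^{\alpha}\sum_{j=1}^{\beta}S_{a_i^-b_j^-}+S_{a_1a_2\cdots a_\alpha}.$$ It is a known result (Czech, Shuai, Wang, Zhang) that this is an HEI for all odd $\alpha,\beta$. An instance of it is obtained by letting $a_1,\dots,a_\alpha,b_1,\dots,b_\beta$ be any pairwise disjoint unions of elementary regions that together exhaust all elementary regions. *)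

(* Defs.v *)
From HB Require Import structures.
From mathcomp Require Import all_boot all_order all_algebra.
Set Implicit Arguments.
Unset Strict Implicit.
Unset Printing Implicit Defensive.
Import Order.TTheory GRing.Theory Num.Theory.
Local Open Scope ring_scope.

(* Throughout, [E] is the finite type of all elementary regions (purifier     *)
(* included), a union of elementary regions is an [omega : {set E}], and an   *)
(* assignment of entropies is a function [S : {set E} -> R].                  *)

(* The inequality  \sum_u c_u S_{L_u} >= \sum_v d_v S_{R_v},  given by the    *)
(* lists of its weighted terms (c_u, L_u) and (d_v, R_v).                     *)
Record entropy_ineq (R : realFieldType) (E : finType) := EntropyIneq {
  larger_terms : seq (R * {set E});
  smaller_terms : seq (R * {set E})
}.

Definition eval_terms (R : realFieldType) (E : finType)
    (ts : seq (R * {set E})) (S : {set E} -> R) : R :=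
  \sum_(t <- ts) t.1 * S t.2.

Definition holds_at (R : realFieldType) (E : finType)
    (q : entropy_ineq R E) (S : {set E} -> R) : bool :=
  eval_terms (smaller_terms q) S <= eval_terms (larger_terms q) S.

Definition positive_coefs (R : realFieldType) (E : finType)
    (q : entropy_ineq R E) : bool :=
  all (fun t => 0 < t.1) (larger_terms q ++ smaller_terms q).

(* A missing edge is an edge of weight 0, parallel edges are added up; the    *)
(* boundary vertices are those whose [colour] is not [None].                  *)
Record graph_model (R : realFieldType) (E : finType) := GraphModel {
  vertex : finType;
  weight : vertex -> vertex -> R;
  colour : vertex -> option E;
  weight_sym : forall u v, weight u v = weight v u;
  weight_ge0 : forall u v, 0 <= weight u v
}.

Definition boundary (R : realFieldType) (E : finType) (G : graph_model R E) :
    {set vertex G} :=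
  [set v | colour v != None].

Definition coloured_in (R : realFieldType) (E : finType) (G : graph_model R E)
    (omega : {set E}) : {set vertex G} :=
  [set v | if colour v is Some e then e \in omega else false].

Definition admissible_cut (R : realFieldType) (E : finType)
    (G : graph_model R E) (omega : {set E}) (W : {set vertex G}) : bool :=
  W :&: boundary G == coloured_in G omega.

Definition cut_weight (R : realFieldType) (E : finType) (G : graph_model R E)
    (W : {set vertex G}) : R :=
  \sum_(u in W) \sum_(v in ~: W) weight u v.

(* The default [coloured_in G omega] of the minimum is itself admissible, see *)
(* [graph_entropyP].                                                          *)
Definition graph_entropy (R : realFieldType) (E : finType)
    (G : graph_model R E) (omega : {set E}) : R :=
  cut_weight [arg min_(W < coloured_in G omega | admissible_cut omega W)
                cut_weight W]%O.

Lemma coloured_in_admissible (R : realFieldType) (E : finType)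
    (G : graph_model R E) (omega : {set E}) :
  admissible_cut omega (coloured_in G omega).
Proof.
by apply/eqP/setP => v; rewrite !inE; case: (colour v) => [e|]; rewrite ?andbT.
Qed.

Lemma graph_entropyP (R : realFieldType) (E : finType)
    (G : graph_model R E) (omega : {set E}) :
  (exists2 W : {set vertex G}, admissible_cut omega W &
     graph_entropy G omega = cut_weight W) /\
  (forall W : {set vertex G}, admissible_cut omega W ->
     graph_entropy G omega <= cut_weight W).
Proof.
rewrite /graph_entropy; case: arg_minP; first exact: coloured_in_admissible.
by move=> W adW minW; split; first by exists W.
Qed.

Definition is_HEI (R : realFieldType) (E : finType) (q : entropy_ineq R E) :
    Prop :=
  positive_coefs q /\ forall G : graph_model R E, holds_at q (graph_entropy G).

(* a_i^{(k)}: the union of the k cyclically consecutive regions starting at   *)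
(* a_i; [ordS] is the successor modulo n.                                     *)
Definition cyc_block (E : finType) (n : nat) (a : 'I_n -> {set E})
    (i : 'I_n) (k : nat) : {set E} :=
  \bigcup_(m < k) a (iter m (@ordS n) i).

Definition block_plus (E : finType) (n : nat) (a : 'I_n -> {set E})
    (i : 'I_n) : {set E} := cyc_block a i (n.+1)./2.

Definition block_minus (E : finType) (n : nat) (a : 'I_n -> {set E})
    (i : 'I_n) : {set E} := cyc_block a i (n.-1)./2.

Definition toric_ineq (R : realFieldType) (E : finType) (alpha beta : nat)
    (a : 'I_alpha -> {set E}) (b : 'I_beta -> {set E}) : entropy_ineq R E :=
  {| larger_terms :=
       [seq (1, block_plus a i :|: block_minus b j)
         | i <- enum 'I_alpha, j <- enum 'I_beta];
     smaller_terms :=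
       rcons [seq (1, block_minus a i :|: block_minus b j)
               | i <- enum 'I_alpha, j <- enum 'I_beta]
             (1, \bigcup_i a i) |}.

(* Pairwise disjoint unions of elementary regions exhausting all of them.     *)
Definition toric_regions (E : finType) (alpha beta : nat)
    (a : 'I_alpha -> {set E}) (b : 'I_beta -> {set E}) : Prop :=
  [/\ forall i i', i != i' -> [disjoint a i & a i'],
      forall j j', j != j' -> [disjoint b j & b j'],
      forall i j, [disjoint a i & b j]
    & (\bigcup_i a i) :|: (\bigcup_j b j) = [set: E]].

(* [a i s] and [b j t] are the elementary regions a_{(i,s)} and b_{(j,t)};    *)
(* the index tuples (i_1,...,i_{n_alpha}) and (j_1,...,j_{n_beta}) are finite *)
(* functions.                                                                 *)
Definition multi_toric_ineq (R : realFieldType) (E : finType)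
    (alpha beta n_alpha n_beta : nat)
    (a : 'I_alpha -> 'I_n_alpha -> E) (b : 'I_beta -> 'I_n_beta -> E) :
    entropy_ineq R E :=
  let A s := fun i : 'I_alpha => [set a i s] in
  let B t := fun j : 'I_beta => [set b j t] in
  {| larger_terms :=
       [seq (1, (\bigcup_s block_plus (A s) (i s))
                :|: (\bigcup_t block_minus (B t) (j t)))
         | i : {ffun 'I_n_alpha -> 'I_alpha} <- enum {ffun 'I_n_alpha -> 'I_alpha},
           j : {ffun 'I_n_beta -> 'I_beta} <- enum {ffun 'I_n_beta -> 'I_beta}];
     smaller_terms :=
       rcons
         [seq (1, (\bigcup_s block_minus (A s) (i s))
                  :|: (\bigcup_t block_minus (B t) (j t)))
           | i : {ffun 'I_n_alpha -> 'I_alpha} <- enum {ffun 'I_n_alpha -> 'I_alpha},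
             j : {ffun 'I_n_beta -> 'I_beta} <- enum {ffun 'I_n_beta -> 'I_beta}]
         ((alpha ^ n_alpha.-1 * beta ^ n_beta.-1)%N%:R,
          \bigcup_s \bigcup_i A s i) |}.

Definition implied_by_toric (R : realFieldType) (E : finType)
    (alpha beta : nat) (q : entropy_ineq R E) : Prop :=
  forall S : {set E} -> R,
    (forall (a : 'I_alpha -> {set E}) (b : 'I_beta -> {set E}),
        toric_regions a b -> holds_at (toric_ineq R a b) S) ->
    holds_at q S.

(* [q] is a finite sum of toric instances, side by side.  As S is arbitrary,  *)
(* both equations are identities between formal linear combinations of the    *)
(* symbols S_omega.                                                           *)
Definition sum_of_toric (R : realFieldType) (E : finType)
    (alpha beta : nat) (q : entropy_ineq R E) : Prop :=
  exists (N : nat) (a : 'I_N -> 'I_alpha -> {set E})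
         (b : 'I_N -> 'I_beta -> {set E}),
    (forall k, toric_regions (a k) (b k)) /\
    forall S : {set E} -> R,
      eval_terms (larger_terms q) S =
        \sum_(k < N) eval_terms (larger_terms (toric_ineq R (a k) (b k))) S /\
      eval_terms (smaller_terms q) S =
        \sum_(k < N) eval_terms (smaller_terms (toric_ineq R (a k) (b k))) S.

(* Main.v *)
Require Import Defs.
From HB Require Import structures.
From mathcomp Require Import all_boot all_order all_algebra.
From mathcomp Require Import zify.
Set Implicit Arguments.
Unset Strict Implicit.
Unset Printing Implicit Defensive.
Import Order.TTheory GRing.Theory Num.Theory.

(* Shifting the list A_s cyclically by p_s and B_t by q_t, with p and q zero  *)
(* on the first list, and gluing the shifted lists region by region gives     *)
(* alpha^(n_alpha-1) beta^(n_beta-1) toric instances.  Each tuple of indices  *)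
(* is hit exactly once, so these add up to the inequality term by term.       *)
(*   The toric inequality itself is proved by a contraction map.  Place the   *)
(* larger terms on the squares and the smaller ones on the vertices of a      *)
(* square tiling of the torus Z_alpha x Z_beta.  A bit string x selects one   *)
(* diagonal in every square, hence a graph on the vertices.  A vertex gets    *)
(* the bit 1 iff it is the first vertex of a bipartite component, and the bit *)
(* of S_A is the parity of x plus the number of these vertices.  Flipping one *)
(* bit of x replaces a diagonal of a square by the other one; following the   *)
(* strands that run between the diagonals out of this square until they       *)
(* return to it shows that at most one vertex bit changes.                    *)

(** An index tuple is the same as its first entry together with the differences of the other entries
    from it ([sum_offset]). For fixed differences the glued lists form one toric instance, and
    [multi_toric_sum] adds these instances up.

    Validity on graphs rests on [contraction_entropy]: a map on bit strings that does not increase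
    Hamming distance and has the right values at the occurrence vectors of the regions assembles
    cuts for the smaller terms out of minimal cuts for the larger ones. The values are checked in
    [toric_contraction_boundary]. For the distance it is enough to flip one bit
    ([flips_contraction]). There [strand] tells how the corners of the flipped square are linked
    outside it, [lost_bip_root_unique] says that a new edge destroys at most one root, and
    [diagonal_flip] combines both. *)

Definition parity_cover (V : finType) (e : rel V) : rel (V * bool) :=
  [rel x y | e x.1 y.1 && (y.2 == ~~ x.2)].

(** Reachability in the bipartite double cover: [b] is the parity of the length. For symmetric [e],
    [walk e v v true] says that the component of [v] is not bipartite. *)
Definition walk (V : finType) (e : rel V) (u v : V) (b : bool) : bool :=
  connect (parity_cover e) (u, false) (v, b).

Definition add_edge (V : finType) (e : rel V) (p q : V) : rel V :=
  [rel x y | e x y || ((x, y) == (p, q)) || ((x, y) == (q, p))].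

(* The first vertex of a bipartite component. *)
Definition bip_root (V : finType) (e : rel V) (v : V) : bool :=
  ~~ walk e v v true &&
  [forall w, forall b, walk e v w b ==> (enum_rank v <= enum_rank w)].

Lemma walk_ind (V : finType) (e : rel V) (u : V) (P : V -> bool -> Prop) :
    P u false -> (forall v w b, P v b -> e v w -> P w (~~ b)) ->
  forall v b, walk e u v b -> P v b.
Proof.
move=> P0 PS v b /connectP[p]; have: P (u, false).1 (u, false).2 by [].
elim: p (u, false) => [|[y c] p IHp] [x d] /= Px; first by move=> _ [-> ->].
case/andP=> /andP[exy /eqP dc] pp; apply: IHp => //=.
by have:= PS _ _ _ Px exy; rewrite -dc.
Qed.

Lemma walk0 (V : finType) (e : rel V) u : walk e u u false.
Proof. exact: connect0. Qed.

Lemma walkS (V : finType) (e : rel V) u v w b :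
  walk e u v b -> e v w -> walk e u w (~~ b).
Proof.
move=> uv vw; apply: connect_trans uv _; apply: connect1.
by rewrite /parity_cover /= vw eqxx.
Qed.

Lemma walk1 (V : finType) (e : rel V) u v : e u v -> walk e u v true.
Proof. exact: walkS (walk0 _ _). Qed.

Lemma walk_trans (V : finType) (e : rel V) v u w b c :
  walk e u v b -> walk e v w c -> walk e u w (b (+) c).
Proof.
move=> uv; elim/walk_ind; first by rewrite addbF.
by move=> x y d ux xy; rewrite addbN; apply: walkS ux xy.
Qed.

Lemma walk_sym (V : finType) (e : rel V) u v b :
  symmetric e -> walk e u v b = walk e v u b.
Proof.
move=> sym_e; suff imp x y c : walk e x y c -> walk e y x c.
  by apply/idP/idP; apply: imp.
elim/walk_ind => [|z t d zx zt]; first exact: walk0.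
by rewrite -addTb; apply: walk_trans zx; apply: walk1; rewrite sym_e.
Qed.

Lemma sub_walk (V : finType) (e e' : rel V) u v b :
  subrel e e' -> walk e u v b -> walk e' u v b.
Proof.
move=> ee'; elim/walk_ind => [|x y c ux xy]; first exact: walk0.
exact: walkS ux (ee' _ _ xy).
Qed.

Lemma eq_bip_root (V : finType) (e e' : rel V) :
  e =2 e' -> bip_root e =1 bip_root e'.
Proof.
move=> ee' v; have wE u w b : walk e u w b = walk e' u w b.
  by apply/idP/idP; apply: sub_walk => x y; rewrite ee'.
rewrite /bip_root wE; congr (_ && _).
by apply: eq_forallb => w; apply: eq_forallb => b; rewrite wE.
Qed.

Lemma bip_rootP (V : finType) (e : rel V) v :
  reflect (~~ walk e v v true /\
           forall w b, walk e v w b -> enum_rank v <= enum_rank w) (bip_root e v).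
Proof.
apply: (iffP andP) => -[odd_v min_v]; split=> //.
  by move=> w b; move/forallP/(_ w)/forallP/(_ b)/implyP: min_v.
by apply/forallP => w; apply/forallP => b; apply/implyP; apply: min_v.
Qed.

Lemma bip_root_walk_eq (V : finType) (e : rel V) v v' b :
  symmetric e -> bip_root e v -> bip_root e v' -> walk e v v' b -> v = v'.
Proof.
move=> sym_e /bip_rootP[_ min_v] /bip_rootP[_ min_v'] vv'.
apply/enum_rank_inj/val_inj/eqP; rewrite eqn_leq (min_v _ _ vv') /=.
by apply: (min_v' _ b); rewrite walk_sym.
Qed.

Lemma walk_odd (V : finType) (e : rel V) u v b :
  symmetric e -> walk e u v b -> walk e v v true -> walk e u u true.
Proof.
move=> sym_e uv vv; have vu := uv; rewrite walk_sym // in vu.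
by have:= walk_trans (walk_trans uv vv) vu; case: (b).
Qed.

(** * Effect of a new edge on the roots *)

Lemma sub_add_edge (V : finType) (e : rel V) p q : subrel e (add_edge e p q).
Proof. by move=> x y exy; rewrite /add_edge /= exy. Qed.

Lemma bip_root_add_edge (V : finType) (e : rel V) p q v :
  bip_root (add_edge e p q) v -> bip_root e v.
Proof.
have sub := @sub_add_edge _ e p q.
move/bip_rootP=> [odd_v min_v]; apply/bip_rootP; split.
  by apply: contra odd_v; apply: sub_walk.
by move=> w b vw; apply: (min_v _ b); apply: sub_walk vw.
Qed.

(** As seen from [v], the ends [p] and [q] are unreachable or already occur with opposite parities,
    so every use of the new edge can be replaced by an old walk. *)
Lemma walk_add_edge (V : finType) (e : rel V) p q v w b :
    (forall c, walk e v p c -> walk e v q (~~ c)) ->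
    (forall c, walk e v q c -> walk e v p (~~ c)) ->
  walk (add_edge e p q) v w b -> walk e v w b.
Proof.
move=> pq qp; elim/walk_ind => [|x y c vx]; first exact: walk0.
case/orP=> [/orP[xy|/eqP[xE yE]]|/eqP[xE yE]]; first exact: walkS vx xy.
  by rewrite yE; apply: pq; rewrite -xE.
by rewrite yE; apply: qp; rewrite -xE.
Qed.

Lemma bip_root_add_edge_eq (V : finType) (e : rel V) p q v :
    (forall c, walk e v p c -> walk e v q (~~ c)) ->
    (forall c, walk e v q c -> walk e v p (~~ c)) ->
  bip_root (add_edge e p q) v = bip_root e v.
Proof.
move=> pq qp; apply/idP/idP; first exact: bip_root_add_edge.
move/bip_rootP=> [odd_v min_v]; apply/bip_rootP; split.
  by apply: contra odd_v; apply: walk_add_edge.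
by move=> w b vw; apply: (min_v _ b); apply: walk_add_edge vw.
Qed.

Lemma bip_root_add_redundant (V : finType) (e : rel V) p q :
  symmetric e -> walk e p q true -> bip_root (add_edge e p q) =1 bip_root e.
Proof.
move=> sym_e pq v; apply: bip_root_add_edge_eq => c vz; rewrite -addbT.
  exact: walk_trans vz pq.
by apply: walk_trans vz _; rewrite walk_sym.
Qed.

Lemma lost_bip_root_end (V : finType) (e : rel V) p q v :
    bip_root e v -> ~~ bip_root (add_edge e p q) v ->
  exists b, walk e v p b || walk e v q b.
Proof.
move=> rv; case: (pickP (fun b => walk e v p b || walk e v q b)) => [b vb _|no].
  by exists b.
rewrite bip_root_add_edge_eq ?rv // => c vc; have:= no c; rewrite vc //.
by rewrite orbT.
Qed.

(** A lost root would reach [p] or [q], and so have an odd closed walk already. *)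
Lemma bip_root_add_odd (V : finType) (e : rel V) p q :
    symmetric e -> walk e p p true -> walk e q q true ->
  bip_root (add_edge e p q) =1 bip_root e.
Proof.
move=> sym_e pp qq v; apply/idP/idP; first exact: bip_root_add_edge.
move=> rv; apply: contraT => /(lost_bip_root_end rv)[b].
have /bip_rootP[odd_v _] := rv.
by case/orP=> vz; rewrite (walk_odd sym_e vz) in odd_v.
Qed.

Lemma add_edgeC (V : finType) (e : rel V) p q :
  add_edge e p q =2 add_edge e q p.
Proof. by move=> x y; rewrite /add_edge /= -!orbA; congr (_ || _); rewrite orbC. Qed.

(** The new edge is a bridge between two bipartite components. Parities are unique inside each, so a
    walk ending on the far side has the parity forced by the passage through [p] and [q]. *)
Lemma walk_join (V : finType) (e : rel V) p q v v' b c :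
    symmetric e -> ~~ walk e v v true -> ~~ walk e v' v' true ->
    (forall d, ~~ walk e v v' d) -> walk e v p b -> walk e v' q c ->
  forall w d, walk (add_edge e p q) v w d ->
    walk e v w d \/ walk e v' w (d (+) b (+) ~~ c).
Proof.
move=> sym_e odd_v odd_v' unlinked vp v'q.
have apart z f g : walk e v z f -> walk e v' z g -> False.
  move=> vz v'z; case/negP: (unlinked (f (+) g)).
  by apply: walk_trans vz _; rewrite walk_sym.
have same x y f g : ~~ walk e x x true -> walk e x y f -> walk e x y g -> f = g.
  move=> odd_x xy xy'; apply: contraNeq odd_x => fg.
  have -> : true = f (+) g by case: f g fg {xy xy'} => -[].
  by apply: walk_trans xy _; rewrite walk_sym.
move=> w d; elim/walk_ind => [|x y g IH]; first by left; apply: walk0.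
case/orP=> [/orP[xy|/eqP[xE yE]]|/eqP[xE yE]].
- by case: IH => vx; [left | right; rewrite !addNb]; apply: walkS vx xy.
- subst x y; case: IH => [vx|v'x]; last by case: (apart _ _ _ vp v'x).
  by right; rewrite (same _ _ _ _ odd_v vx vp) addNb addbb addTb negbK.
- subst x y; case: IH => [vx|v'x]; first by case: (apart _ _ _ vx v'q).
  left; have := same _ _ _ _ odd_v' v'x v'q.
  by move: vp; case: (g); case: (b); case: (c).
Qed.

(** Two distinct lost roots would lie in different components, one containing [p] and the other [q].
    Joining these gives a bipartite component, of which the smaller root is still the first vertex,
    so that root is not lost. *)
Lemma lost_bip_root_unique (V : finType) (e : rel V) p q v v' :
    symmetric e -> bip_root e v -> ~~ bip_root (add_edge e p q) v ->
    bip_root e v' -> ~~ bip_root (add_edge e p q) v' ->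
  v = v'.
Proof.
move=> sym_e; wlog: v v' / enum_rank v <= enum_rank v'.
  move=> th rv lv rv' lv'; case/orP: (leq_total (enum_rank v) (enum_rank v')).
    by move=> le_vv'; apply: th.
  by move=> le_v'v; apply/esym/th.
move=> le_vv' rv lv rv' lv'; apply/eqP/negPn/negP => neq_vv'.
have unlinked b : ~~ walk e v v' b.
  by apply: contra neq_vv' => /(bip_root_walk_eq sym_e rv rv')->.
have [/bip_rootP[odd_v min_v] /bip_rootP[odd_v' min_v']] := (rv, rv').
have keep s t b c : walk e v s b -> walk e v' t c -> bip_root (add_edge e s t) v.
  move=> vs v't.
  have join := walk_join sym_e odd_v odd_v' unlinked vs v't.
  apply/bip_rootP; split.
    apply/negP => /join[vv|v'v]; first by rewrite vv in odd_v.
    by case/negP: (unlinked (true (+) b (+) ~~ c)); rewrite walk_sym.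
  move=> w f /join[/min_v //|v'w].
  by apply: leq_trans le_vv' _; apply: min_v' v'w.
have both z b c : walk e v z b -> walk e v' z c -> False.
  move=> vz v'z; case/negP: (unlinked (b (+) c)).
  by apply: walk_trans vz _; rewrite walk_sym.
have [b vb] := lost_bip_root_end rv lv; have [c vc] := lost_bip_root_end rv' lv'.
case/orP: vb => vb; case/orP: vc => vc.
- exact: both vb vc.
- by rewrite (keep _ _ _ _ vb vc) in lv.
- by rewrite (eq_bip_root (add_edgeC e p q)) (keep _ _ _ _ vb vc) in lv.
- exact: both vb vc.
Qed.

Local Open Scope ring_scope.

(** * Diagonals of a square tiling and the strands between them *)

Definition signed (T : zmodType) (d : bool) (z : T) : T := if d then z else - z.

(* The square s has the corners s - u, s + u and s - w, s + w.                *)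
Definition diagonal (T : finZmodType) (u w : T) (x : pred T) (s : T) : T * T :=
  if x s then (s - w, s + w) else (s - u, s + u).

Definition diagonal_graph (T : finZmodType) (u w : T) (D x : pred T) : rel T :=
  [rel y z | [exists s, D s &&
     (((y, z) == diagonal u w x s) || ((z, y) == diagonal u w x s))]].

(* The state (s, (dx, dy)) of a strand: it leaves the square s through the    *)
(* side between the corners s +/- u and s +/- w, with signs dx and dy.  In    *)
(* the next square it is reflected by the diagonal that it meets.             *)
Definition turn (T : finZmodType) (u w : T) (x : pred T)
    (z : T * (bool * bool)) : T * (bool * bool) :=
  let s := z.1 + signed z.2.1 u + signed z.2.2 w in
  if x s then (s, (~~ z.2.1, z.2.2)) else (s, (z.2.1, ~~ z.2.2)).

(** The same side, crossed in the opposite direction. *)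
Definition reverse (T : finZmodType) (u w : T) (z : T * (bool * bool)) :
    T * (bool * bool) :=
  (z.1 + signed z.2.1 u + signed z.2.2 w, (~~ z.2.1, ~~ z.2.2)).

Lemma signedN (T : zmodType) d (z : T) : signed (~~ d) z = - signed d z.
Proof. by case: d; rewrite //= opprK. Qed.

Lemma diagonal_graph_sym (T : finZmodType) (u w : T) D x :
  symmetric (diagonal_graph u w D x).
Proof. by move=> y z; apply: eq_existsb => s; rewrite orbC. Qed.

Lemma diagonal_graphP (T : finZmodType) (u w : T) (D x : pred T) s :
  D s -> diagonal_graph u w D x (diagonal u w x s).1 (diagonal u w x s).2.
Proof.
by move=> Ds; apply/existsP; exists s; rewrite Ds -surjective_pairing eqxx.
Qed.

Lemma diagonal_graphD1 (T : finZmodType) (u w : T) (x : pred T) s :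
  diagonal_graph u w predT x =2
  add_edge (diagonal_graph u w (predC1 s) x)
    (diagonal u w x s).1 (diagonal u w x s).2.
Proof.
move=> y z; rewrite /add_edge /= -surjective_pairing.
have -> : ((y, z) == ((diagonal u w x s).2, (diagonal u w x s).1)) =
          ((z, y) == diagonal u w x s).
  by case: (diagonal u w x s) => p q; rewrite !xpair_eqE andbC.
apply/existsP/idP => [[t /= yz]|].
  have [<-|ts] := eqVneq t s; first by rewrite -orbA yz orbT.
  by rewrite -orbA; apply/orP; left; apply/existsP; exists t; rewrite /= ts.
rewrite -orbA => /orP[/existsP[t /andP[_ yz]]|yz]; [by exists t | by exists s].
Qed.

Lemma eq_diagonal_graph (T : finZmodType) (u w : T) (D x x' : pred T) :
  {in D, x =1 x'} -> diagonal_graph u w D x =2 diagonal_graph u w D x'.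
Proof.
move=> xx' y z; apply: eq_existsb => s; have [Ds|] //= := boolP (D s).
by rewrite /diagonal xx'.
Qed.

Lemma reverseK (T : finZmodType) (u w : T) : involutive (reverse u w).
Proof.
case=> s [dx dy]; rewrite /reverse /= !signedN !negbK; congr (_, _).
by rewrite addrAC addrK addrK.
Qed.

(** Running back, a strand meets the same diagonal and leaves by the side through which it came:
    [reverse] conjugates [turn] to its inverse. *)
Lemma reverse_turn (T : finZmodType) (u w : T) (x : pred T) z :
  turn u w x (reverse u w (turn u w x z)) = reverse u w z.
Proof.
have cycleK (t a b : T) : t - a + b + a - b = t.
  by rewrite (addrAC (t - a)) subrK addrK.
case: z => s [dx dy]; rewrite /turn /reverse /=.
set t := s + _ + _; case xt: (x t) => /=; rewrite !signedN ?negbK opprK.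
  by rewrite cycleK xt.
have := cycleK t (- signed dx u) (- signed dy w); rewrite !opprK => ->.
by rewrite xt.
Qed.

Lemma turn_inj (T : finZmodType) (u w : T) (x : pred T) :
  injective (turn u w x).
Proof.
move=> y z /(congr1 (reverse u w)) /(congr1 (turn u w x)).
by rewrite !reverse_turn => /(can_inj (reverseK u w)).
Qed.

(** Cutting one turn off both ends of a strand that comes back along itself leaves a shorter one.
    This ends at length 0 or 1, where fewer than two signs have changed. *)
Lemma iter_turn_neq_reverse (T : finZmodType) (u w : T) (x : pred T) n z :
  iter n (turn u w x) z != reverse u w z.
Proof.
elim/ltn_ind: n z => -[|[|n]] IH z.
- case: z => s [dx dy]; apply/eqP => -[_ /eqP].
  by case: dx.
- case: z => s [dx dy]; apply/eqP; rewrite /= /turn /reverse /=.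
  by case: ifP => _ -[/eqP]; case: dx; case: dy.
apply/eqP => zn; case/eqP: (IH n (ltnW (ltnSn _)) (turn u w x z)).
by apply: (@turn_inj _ u w x); rewrite reverse_turn -zn -iterS -iterSr.
Qed.

Lemma turn_returns (T : finZmodType) (u w : T) (x : pred T) z :
  exists n, (turn u w x (iter n (turn u w x) z)).1 = z.1.
Proof.
exists (fingraph.order (turn u w x) z).-1; rewrite -iterS prednK ?order_gt0 //.
by rewrite iter_order //; apply: turn_inj.
Qed.

(* A turn advances exactly one of the two corners beside the strand along a   *)
(* diagonal and exchanges their roles, so the two walks have total length n.  *)
Lemma strand_walks (T : finZmodType) (u w : T) (x : pred T) s d n z :
    z = iter n (turn u w x) (s, d) ->
    (forall m, (m < n)%N -> (turn u w x (iter m (turn u w x) (s, d))).1 != s) ->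
  let H := diagonal_graph u w (predC1 s) x in
  let P z := z.1 + signed z.2.1 u in let Q z := z.1 + signed z.2.2 w in
  exists b, if odd n then
      [/\ walk H (P (s, d)) (Q z) b, walk H (Q (s, d)) (P z) (~~ b)
        & (z.2.1 == d.1) = (z.2.2 != d.2)]
    else [/\ walk H (P (s, d)) (P z) b, walk H (Q (s, d)) (Q z) b
        & (z.2.1 == d.1) = (z.2.2 == d.2)].
Proof.
move=> zE avoid H P Q; elim: n z zE avoid => [|n IH] z zE avoid.
  by exists false; rewrite zE /= !eqxx; split=> //; apply: walk0.
have {IH} := IH _ erefl (fun m mn => avoid m (ltnW mn)).
have := avoid n (ltnSn n); rewrite iterS in zE.
move: (iter n _ _) zE => [t [dx dy]] zE; rewrite -zE.
move: zE; rewrite /turn /=; set t' := t + _ + _ => zE t's [b IH].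
have edge : H (diagonal u w x t').1 (diagonal u w x t').2.
  by apply: diagonal_graphP; move: t's; rewrite zE; case: ifP.
have Hsym : symmetric H by apply: diagonal_graph_sym.
have PE : P (t, (dx, dy)) = t' - signed dy w by rewrite /P /= /t' addrK.
have QE : Q (t, (dx, dy)) = t' - signed dx u by rewrite /Q /= /t' addrAC addrK.
move: edge; rewrite /diagonal; move: zE; case: (x t') => zE /= edge.
- have PQ y c : walk H y (P (t, (dx, dy))) c -> walk H y (Q z) (~~ c).
    move=> yP; apply: walkS yP _; rewrite PE zE /Q /=.
    by case: (dy); rewrite /= ?opprK // Hsym.
  have QP : Q (t, (dx, dy)) = P z by rewrite QE zE /P /= signedN.
  exists (if odd n then b else ~~ b); rewrite /=.
  case: (odd n) IH => /= -[w1 w2 dE].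
    split.
    + by rewrite -QP.
    + by have:= PQ _ _ w2; rewrite negbK.
    + by rewrite zE /=; move: dE; case: (dx) (d.1) (dy) (d.2) => -[] [] [].
  split.
  + exact: PQ.
  + by rewrite -QP negbK.
  + by rewrite zE /=; move: dE; case: (dx) (d.1) (dy) (d.2) => -[] [] [].
- have QP y c : walk H y (Q (t, (dx, dy))) c -> walk H y (P z) (~~ c).
    move=> yQ; apply: walkS yQ _; rewrite QE zE /P /=.
    by case: (dx); rewrite /= ?opprK // Hsym.
  have PQ : P (t, (dx, dy)) = Q z by rewrite PE zE /Q /= signedN.
  exists (if odd n then ~~ b else b); rewrite /=.
  case: (odd n) IH => /= -[w1 w2 dE].
    split.
    + exact: QP.
    + by rewrite -PQ.
    + by rewrite zE /=; move: dE; case: (dx) (d.1) (dy) (d.2) => -[] [] [].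
  split.
  + by rewrite -PQ.
  + exact: QP.
  + by rewrite zE /=; move: dE; case: (dx) (d.1) (dy) (d.2) => -[] [] [].
Qed.

(** The strand is followed until just before it first re-enters [s], so it uses only diagonals of
    other squares. It cannot re-enter by the side through which it left; the three cases are the
    other three sides. *)
Lemma strand (T : finZmodType) (u w : T) (x : pred T) s dx dy :
  let H := diagonal_graph u w (predC1 s) x in
  let P d := s + signed d u in let Q d := s + signed d w in
  exists b,
    [\/ walk H (P dx) (P (~~ dx)) b /\ walk H (Q dy) (Q dy) (~~ b),
        walk H (Q dy) (Q (~~ dy)) b /\ walk H (P dx) (P dx) (~~ b)
      | walk H (P dx) (Q (~~ dy)) b /\ walk H (Q dy) (P (~~ dx)) b].
Proof.
move=> H P Q; pose z0 := (s, (dx, dy)).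
pose back n := (turn u w x (iter n (turn u w x) z0)).1 == s.
have [n /eqP zn avoid] : exists2 n, back n & forall m, (m < n)%N -> ~~ back m.
  have ex_back : exists n, back n.
    by have [n /eqP] := turn_returns u w x z0; exists n.
  case: (ex_minnP ex_back) => n bn minn; exists n => // m.
  by rewrite ltnNge; apply: contra; apply: minn.
have := @strand_walks T u w x s (dx, dy) n _ erefl avoid.
have := iter_turn_neq_reverse u w x n z0.
rewrite -/z0; move: (iter n _ _) zn => [t [ex ey]] /=.
rewrite /turn /= => tE; have {tE} : t + signed ex u + signed ey w = s.
  by move: tE; case: ifP.
(* The corners beside the last state are corners of [s], with the roles of [u] and [w] exchanged. *)
move=> tE; have PE : t + signed ex u = s - signed ey w by rewrite -tE addrK.
have QE : t + signed ey w = s - signed ex u by rewrite -tE addrAC addrK.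
rewrite PE QE -!signedN => nrev [b].
have turned : (ex, ey) != (~~ dx, ~~ dy).
  apply: contra nrev => /eqP[exE eyE]; apply/eqP; rewrite /reverse /= exE eyE.
  by congr (_, _); rewrite -tE exE eyE !signedN (addrAC (t - _)) !subrK.
case: (odd n) => -[w1 w2 dE].
  have [exE|exN] := eqVneq ex dx.
    have eyE : ey = ~~ dy by move: dE; rewrite exE eqxx; case: (ey) (dy) => -[].
    by exists b; apply: Or31; move: w1 w2; rewrite exE eyE negbK.
  have eyE : ey = dy by move: dE; rewrite (negPf exN); case: (ey) (dy) => -[].
  have exE : ex = ~~ dx by move: exN; case: (ex) (dx) => -[].
  by exists (~~ b); apply: Or32; move: w1 w2; rewrite exE eyE !negbK.
have [exE eyE] : ex = dx /\ ey = dy.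
  by move: dE turned; case: (ex) (dx) (ey) (dy) => -[] [] [].
by exists b; apply: Or33; move: w1 w2; rewrite exE eyE.
Qed.

(** A vertex whose bit changes is a root of [H], the graph without the diagonal of [s], and is lost
    under one of the two diagonals. If one diagonal loses no root, the other loses at most one. If
    all four corners lie in one component of [H], only its root can be lost. The strands out of [s]
    show that one of these always happens. *)
Lemma diagonal_flip (T : finZmodType) (u w : T) (x x' : pred T) s v v' :
    {in predC1 s, x =1 x'} ->
    let r y := bip_root (diagonal_graph u w predT y) in
  r x v != r x' v -> r x v' != r x' v' -> v = v'.
Proof.
move=> xx' r; pose H := diagonal_graph u w (predC1 s) x.
have Hsym : symmetric H by apply: diagonal_graph_sym.
pose rP := bip_root (add_edge H (s - u) (s + u)).
pose rQ := bip_root (add_edge H (s - w) (s + w)).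
have rE y : {in predC1 s, x =1 y} -> r y =1 if y s then rQ else rP.
  move=> xy z; rewrite /r (eq_bip_root (diagonal_graphD1 u w y s)).
  have HE : diagonal_graph u w (predC1 s) y =2 H.
    by move=> a b; apply: eq_diagonal_graph => c sc; rewrite xy.
  rewrite /diagonal; case: (y s); apply: eq_bip_root => a b;
    by rewrite /add_edge /= HE.
suff main : rP v != rQ v -> rP v' != rQ v' -> v = v'.
  rewrite !rE //; case: (x s) (x' s) => -[]; rewrite ?eqxx //.
  by rewrite ![rQ _ == _]eq_sym.
have lostP z : rP z != rQ z -> bip_root H z /\ (~~ rP z \/ ~~ rQ z).
  case rPz: (rP z); case rQz: (rQ z) => // _.
    by split; [apply: bip_root_add_edge rPz | right].
  by split; [apply: bip_root_add_edge rQz | left].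
move=> /[dup] vPQ /lostP[rv lv] /[dup] v'PQ /lostP[rv' lv'].
have onlyQ : rP =1 bip_root H -> v = v'.
  move=> PH; apply: (lost_bip_root_unique Hsym rv _ rv').
    by case: lv; [rewrite PH rv | apply].
  by case: lv'; [rewrite PH rv' | apply].
have onlyP : rQ =1 bip_root H -> v = v'.
  move=> QH; apply: (lost_bip_root_unique Hsym rv _ rv').
    by case: lv; [apply | rewrite QH rv].
  by case: lv'; [apply | rewrite QH rv'].
pose linked y z := exists b, walk H y z b.
have link y z b : walk H y z b -> linked y z by exists b.
have linkS y z : linked y z -> linked z y.
  by case=> b; rewrite walk_sym // => zy; exists b.
have linkT y z t : linked y z -> linked z t -> linked y t.
  by case=> b yz [c zt]; exists (b (+) c); apply: walk_trans yz zt.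
have odd_linked y z : linked y z -> walk H z z true -> walk H y y true.
  by case=> b yz; apply: walk_odd yz.
have all_linked : linked (s + u) (s - u) -> linked (s + u) (s + w) ->
    linked (s + u) (s - w) -> v = v'.
  move=> PP' PQ PQ'; have endP z : bip_root H z -> ~~ rP z \/ ~~ rQ z ->
      linked z (s + u).
    by move=> rz [] /(lost_bip_root_end rz)[b /orP[]] /link // zy;
      apply: linkT zy _; apply: linkS.
  have [b vv'] := linkT _ _ _ (endP _ rv lv) (linkS _ _ (endP _ rv' lv')).
  exact: bip_root_walk_eq vv'.
have PPredundant : walk H (s - u) (s + u) true -> v = v'.
  by move=> PP; apply: onlyQ; apply: bip_root_add_redundant.
have QQredundant : walk H (s - w) (s + w) true -> v = v'.
  by move=> QQ; apply: onlyP; apply: bip_root_add_redundant.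
have PPodd : walk H (s - u) (s - u) true -> walk H (s + u) (s + u) true -> v = v'.
  by move=> P'P' PP; apply: onlyQ; apply: bip_root_add_odd.
have QQodd : walk H (s - w) (s - w) true -> walk H (s + w) (s + w) true -> v = v'.
  by move=> Q'Q' QQ; apply: onlyP; apply: bip_root_add_odd.
(* Unless the first strand already makes a diagonal redundant, a second one, through a side sharing
   a corner with the first, decides. *)
have [b1 []] := strand u w x s true true; rewrite /= -/H => -[s1 s2].
- case: b1 s1 s2 => /= PP' QQ; first by apply: PPredundant; rewrite walk_sym.
  have [b2 []] := strand u w x s true false; rewrite /= -/H => -[s3 s4].
  + case: b2 s3 s4 => /= PP'2 Q'Q'; last exact: QQodd.
    by apply: PPredundant; rewrite walk_sym.
  + case: b2 s3 s4 => /= Q'Q PP; first exact: QQredundant.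
    by apply: PPodd => //; apply: odd_linked PP; apply/linkS/link/PP'.
  + apply: all_linked; [exact: link PP'|exact: link s3|].
    by apply: linkT (link _ _ _ PP') _; apply/linkS/link/s4.
- case: b1 s1 s2 => /= QQ' PP; first by apply: QQredundant; rewrite walk_sym.
  have [b2 []] := strand u w x s false true; rewrite /= -/H => -[s3 s4].
  + case: b2 s3 s4 => /= P'P QQ; first exact: PPredundant.
    by apply: QQodd => //; apply: odd_linked QQ; apply/linkS/link/QQ'.
  + case: b2 s3 s4 => /= QQ'2 P'P'; last exact: PPodd.
    by apply: QQredundant; rewrite walk_sym.
  + have PQ := linkS _ _ (link _ _ _ s4); have P'Q' := link _ _ _ s3.
    have PQ' := linkT _ _ _ PQ (link _ _ _ QQ').
    by apply: all_linked => //; apply: linkT PQ' _; apply: linkS.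
- have PQ' := link _ _ _ s1; have QP' := link _ _ _ s2.
  have [b2 []] := strand u w x s true false; rewrite /= -/H => -[s3 s4].
  + have PP' := link _ _ _ s3.
    by apply: all_linked => //; apply: linkT PP' _; apply: linkS.
  + have PQ := linkT _ _ _ PQ' (link _ _ _ s3).
    by apply: all_linked => //; apply: linkT PQ QP'.
  + have PQ := link _ _ _ s3.
    by apply: all_linked => //; apply: linkT PQ QP'.
Qed.

(** * Contractions for the Hamming distance *)

Definition mismatch (I : finType) (x y : pred I) : nat :=
  #|[pred i | x i != y i]|.

Lemma mismatch_trans (I : finType) (y x z : pred I) :
  (mismatch x z <= mismatch x y + mismatch y z)%N.
Proof.
rewrite /mismatch -cardUI; apply: leq_trans (leq_addr _ _).
apply/subset_leq_card/subsetP => i; rewrite !inE.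
by case: (x i) (y i) (z i) => -[] [].
Qed.

(** Go from [x] to [x'] one flip at a time and use the triangle inequality. *)
Lemma flips_contraction (I J : finType) (f : {ffun I -> bool} -> pred J) :
    (forall (x x' : {ffun I -> bool}) s,
      {in predC1 s, x =1 x'} -> (mismatch (f x) (f x') <= 1)%N) ->
  forall x x', (mismatch (f x) (f x') <= mismatch x x')%N.
Proof.
move=> flip x x'; elim: {x}_.+1 {-2}x (ltnSn (mismatch x x')) => // n IH x.
rewrite ltnS => le_n; have [s xs|same] := pickP [pred i | x i != x' i]; last first.
  have -> : x = x' by apply/ffunP => i; apply/eqP/negbFE/same.
  by rewrite /mismatch eq_card0 // => j; rewrite !inE eqxx.
pose y := [ffun i => if i == s then x' i else x i].
have xy : {in predC1 s, x =1 y} by move=> i /= /negPf si; rewrite ffunE si.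
have mE : mismatch x x' = (mismatch y x').+1.
  rewrite /mismatch (cardD1 s) [s \in _]xs add1n; congr _.+1; apply: eq_card => i.
  by rewrite !inE ffunE; case: eqP => [->|]; rewrite ?eqxx.
rewrite mE; apply: leq_trans (mismatch_trans (f y) _ _) _.
by rewrite -add1n leq_add ?(flip _ _ s) // IH // -mE.
Qed.

Lemma odd_card_flip (I : finType) (A B : pred I) s :
  {in predC1 s, A =1 B} -> A s != B s ->
  odd #|[pred i | A i]| = ~~ odd #|[pred i | B i]|.
Proof.
move=> AB ABs; rewrite (cardD1 s [pred i | A i]) (cardD1 s [pred i | B i]) !oddD.
have -> : #|[predD1 [pred i | A i] & s]| = #|[predD1 [pred i | B i] & s]|.
  by apply: eq_card => i; rewrite !inE; case: eqVneq => //= si; apply: AB.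
by rewrite -addNb; congr (_ (+) _); move: ABs; rewrite !inE;
  case: (A s) (B s) => -[].
Qed.

Definition toric_contraction (T : finZmodType) (u w : T)
    (x : {ffun T -> bool}) : pred (option T) := fun j =>
  let y := bip_root (diagonal_graph u w predT x) in
  if j is Some v then y v else odd (#|[pred s | x s]| + #|[pred v | y v]|).

(** By the choice of the bit [None], which stands for S_A, the whole output has the parity of [x]. A
    flip thus changes an odd number of output bits; at most one of them is a vertex bit, so exactly
    one bit changes. *)
Lemma toric_contractionP (T : finZmodType) (u w : T) x x' :
  (mismatch (toric_contraction u w x) (toric_contraction u w x')
    <= mismatch x x')%N.
Proof.
apply: flips_contraction => {}x {}x' s xx'.
have [xs|xs] := eqVneq (x s) (x' s).
  have -> : x = x'.
    by apply/ffunP => i; have [->|/xx'] := eqVneq i s.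
  by rewrite /mismatch eq_card0 // => j; rewrite !inE eqxx.
pose r y := bip_root (diagonal_graph u w predT y).
have oddx := odd_card_flip xx' xs.
have flip := diagonal_flip xx'.
have none v : r x v != r x' v ->
    toric_contraction u w x None = toric_contraction u w x' None.
  move=> rv; rewrite /toric_contraction !oddD oddx.
  have /odd_card_flip -> // : {in predC1 v, r x =1 r x'}.
    move=> z /= zv; apply/eqP; apply: contraNT zv => rz.
    by apply/eqP/(flip u w).
  by rewrite addbN addNb negbK.
apply/card_le1_eqP => -[v|] [v'|]; rewrite !inE //.
- by move=> rv rv'; rewrite (flip u w _ _ rv rv').
- by move=> /none ->; rewrite eqxx.
- by move=> nn /none nE; rewrite nE eqxx in nn.
Qed.

(** * From contractions to graph entropies *)

Lemma cut_weight2 (R : realFieldType) (E : finType) (G : graph_model R E)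
    (W : {set vertex G}) :
  cut_weight W *+ 2 =
    \sum_u \sum_v ((u \in W) != (v \in W))%:R * weight u v.
Proof.
have cE (A : {set vertex G}) : \sum_(u in A) \sum_(v in ~: A) weight u v =
    \sum_u \sum_v ((u \in A) && (v \notin A))%:R * weight u v.
  rewrite big_mkcond; apply: eq_bigr => u _; case: (u \in A) => /=; last first.
    by rewrite big1 // => v _; rewrite mul0r.
  rewrite big_mkcond; apply: eq_bigr => v _.
  by rewrite inE; case: (v \in A); rewrite /= ?mul0r ?mul1r.
rewrite mulr2n /cut_weight {1}cE cE [X in _ + X]exchange_big -big_split /=.
apply: eq_bigr => u _; rewrite -big_split; apply: eq_bigr => v _ /=.
rewrite [weight v u]weight_sym -mulrDl -natrD; congr (_%:R * _).
by case: (u \in W) (v \in W) => -[].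
Qed.

(** With minimal cuts [W i], a vertex [v] is put into [U j] according to [f] of its membership bits.
    The boundary values make [U j] admissible, and no pair of vertices is separated by more of the
    [U j] than of the [W i]. *)
Lemma contraction_entropy (R : realFieldType) (E I J : finType)
    (L : I -> {set E}) (M : J -> {set E}) (f : {ffun I -> bool} -> pred J)
    (G : graph_model R E) :
    (forall x x', (mismatch (f x) (f x') <= mismatch x x')%N) ->
    (forall e j, f [ffun i => e \in L i] j = (e \in M j)) ->
  \sum_j graph_entropy G (M j) <= \sum_i graph_entropy G (L i).
Proof.
move=> contr bound.
have /fin_all_exists[W WP] i : exists W : {set vertex G},
    admissible_cut (L i) W /\ graph_entropy G (L i) = cut_weight W.
  by have [[W adW entW] _] := graph_entropyP G (L i); exists W.
pose occ v := [ffun i => v \in W i].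
pose U j := [set v | f (occ v) j].
have adU j : admissible_cut (M j) (U j).
  apply/eqP/setP => v; rewrite !inE; case col: (colour v) => [e|]; last first.
    by rewrite andbF.
  rewrite andbT -bound; congr (f _ j); apply/ffunP => i; rewrite !ffunE.
  have [/eqP/setP/(_ v)] := WP i.
  by rewrite !inE col andbT.
apply: (@le_trans _ _ (\sum_j cut_weight (U j))).
  by apply: ler_sum => j _; have [_] := graph_entropyP G (M j); apply.
have -> : \sum_i graph_entropy G (L i) = \sum_i cut_weight (W i).
  by apply: eq_bigr => i _; have [] := WP i.
have sumE (K : finType) (A : K -> {set vertex G}) :
    (\sum_k cut_weight (A k)) *+ 2 = \sum_u \sum_v
      (mismatch (fun k => u \in A k) (fun k => v \in A k))%:R * weight u v.
  rewrite -sumrMnl; under eq_bigr do rewrite cut_weight2.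
  rewrite exchange_big; apply: eq_bigr => u _.
  rewrite exchange_big; apply: eq_bigr => v _ /=.
  rewrite -mulr_suml -natr_sum; congr (_%:R * _).
  rewrite /mismatch -sum1_card [RHS]big_mkcond; apply: eq_bigr => k _.
  by rewrite inE; case: ifP.
rewrite -(ler_pMn2r (ltn0Sn 1)) !sumE.
apply: ler_sum => u _; apply: ler_sum => v _.
apply: ler_wpM2r; first exact: weight_ge0.
rewrite ler_nat; apply: leq_trans (leq_trans (contr (occ u) (occ v)) _);
  by apply/eq_leq/eq_card => i; rewrite !inE ?ffunE.
Qed.

(** * Boundary values on the torus, as a finite group *)

HB.instance Definition _ (A B : finZmodType) := GRing.Zmodule.on (A * B)%type.

Lemma bip_root_isolated (V : finType) (e : rel V) v :
  (forall z, ~~ e v z) -> bip_root e v.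
Proof.
move=> iso; have vE w b : walk e v w b -> w = v /\ b = false.
  elim/walk_ind => // x y c [-> _] vy.
  by have := iso y; rewrite vy.
apply/bip_rootP; split; first by apply/negP => /vE[].
by move=> w b /vE[->].
Qed.

Lemma diagonal_graph_isolated (T : finZmodType) (u w : T) (x : pred T) v :
    x (v + u) -> x (v - u) -> ~~ x (v + w) -> ~~ x (v - w) ->
  bip_root (diagonal_graph u w predT x) v.
Proof.
move=> xu xu' xw xw'; apply: bip_root_isolated => z.
apply/existsP => -[s /=]; rewrite /diagonal; case xs: (x s);
  rewrite !xpair_eqE => /orP[] /andP[] /eqP ? /eqP ?; subst.
- by rewrite subrK xs in xw.
- by rewrite addrK xs in xw'.
- by rewrite subrK xs in xu.
- by rewrite addrK xs in xu'.
Qed.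

(** The diagonals in direction [g] chain up to a walk in steps [g + g], which is back at [v] after
    the odd number [N] of steps. *)
Lemma diagonal_graph_cycle (T : finZmodType) (u w g : T) (x : pred T) v N :
    (forall k, diagonal u w x (v + g *+ k) =
               (v + g *+ k - g, v + g *+ k + g)) ->
    odd N -> g *+ N = 0 ->
  ~~ bip_root (diagonal_graph u w predT x) v.
Proof.
move=> diag oddN gN; have step k :
    walk (diagonal_graph u w predT x) v (v + (g + g) *+ k) (odd k).
  elim: k => [|k IH]; first by rewrite addr0; apply: walk0.
  apply: walkS IH _.
  have := @diagonal_graphP T u w predT x (v + g *+ k.*2.+1) isT.
  rewrite diag /=; congr (diagonal_graph _ _ _ _ _ _).
    by rewrite -mulr2n -mulrnA mul2n mulrSr addrA addrK.
  by rewrite -mulr2n -mulrnA mul2n doubleS -addrA -mulrSr.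
by apply/negP => /bip_rootP[/negP[]]; have := step N;
  rewrite mulrnDl gN addr0 addr0 oddN.
Qed.

Lemma val_addZp (n : nat) (t : 'I_n.+1) k : (k <= n.+1)%N ->
  val (t + inZp k) = (if t + k < n.+1 then t + k else t + k - n.+1)%N.
Proof.
move=> kn; rewrite /= modnDmr; have [lt_tk|le_tk] := ltnP; first exact: modn_small.
rewrite -{1}(subnK le_tk) modnDr modn_small //.
by have := ltn_ord t; lia.
Qed.

(* The solution of x + x = 1 in Z_(n+1) for n + 1 odd. *)
Definition half (n : nat) : 'I_n.+1 := inZp n.+2./2.

Lemma val_sub_half (n : nat) (t : 'I_n.+1) : odd n.+1 ->
  val (t - half n) = (if t + n./2 < n.+1 then t + n./2 else t + n./2 - n.+1)%N.
Proof.
move=> odd_n; rewrite -val_addZp; last by lia.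
congr val; congr (_ + _); apply/eqP; rewrite eq_sym -addr_eq0.
apply/eqP/val_inj; rewrite /= modnDm.
have -> : (n./2 + n.+2./2 = n.+1)%N by lia.
exact: modnn.
Qed.

Lemma val_add_half (n : nat) (t : 'I_n.+1) :
  val (t + half n) =
    (if t + n.+2./2 < n.+1 then t + n.+2./2 else t + n.+2./2 - n.+1)%N.
Proof. by rewrite val_addZp //; lia. Qed.

Lemma half_mulrn (n : nat) : half n *+ n.+1 = 0.
Proof. by apply/val_inj; rewrite Zp_mulrn /= modnMl. Qed.

Lemma iter_ordS (n : nat) (i : 'I_n.+1) m : iter m (@ordS _) i = i + inZp m.
Proof.
elim: m => [|m IH]; first by apply/val_inj; rewrite /= mod0n addn0 modn_small.
by apply/val_inj; rewrite iterS IH /= !modnDmr addnS -addn1 modnDml addn1.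
Qed.

Lemma mem_cyc_block (E : finType) (n : nat) (a : 'I_n.+1 -> {set E}) e k i m :
    (forall i i', i != i' -> [disjoint a i & a i']) ->
    e \in a k -> (m <= n.+1)%N ->
  (e \in cyc_block a i m) = (val (k - i)%R < m)%N.
Proof.
move=> disj ek mn; have kP k' : e \in a k' -> k' = k.
  move=> ek'; apply/eqP/negPn/negP => /disj /disjoint_setI0/setP/(_ e).
  by rewrite !inE ek ek'.
apply/bigcupP/idP => [[l _]|ltk].
  rewrite iter_ordS => /kP <-; rewrite addrAC subrr add0r.
  by rewrite /= modn_small ?(leq_trans (ltn_ord l)).
exists (Ordinal ltk) => //; rewrite iter_ordS /=.
have -> // : i + inZp (k - i)%R = k.
by rewrite valZpK addrC subrK.
Qed.

Lemma notin_cyc_block (E : finType) (n : nat) (a : 'I_n -> {set E}) e i m :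
  (forall k, e \notin a k) -> e \notin cyc_block a i m.
Proof. by move=> ea; apply/bigcupP => -[l _]; apply/negP. Qed.

(* On the occurrence vector of a region in some a_k the vertex bits are the   *)
(* complement of x, on that of a region in some b_l they equal x: a vertex is *)
(* either isolated or on a straight cycle of odd length alpha or beta.        *)
Lemma toric_contraction_boundary (E : finType) (n m : nat)
    (a : 'I_n.+1 -> {set E}) (b : 'I_m.+1 -> {set E})
    (L : 'I_n.+1 * 'I_m.+1 -> {set E})
    (M : option ('I_n.+1 * 'I_m.+1) -> {set E}) e j :
    odd n.+1 -> odd m.+1 -> toric_regions a b ->
    (forall s, L s = block_plus a s.1 :|: block_minus b s.2) ->
    (forall v, M (Some v) =
       block_minus a (v.1 + half n) :|: block_minus b v.2) ->
    M None = \bigcup_i a i ->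
  toric_contraction ((half n, 0) : 'I_n.+1 * 'I_m.+1) (0, half m)
    [ffun s => e \in L s] j = (e \in M j).
Proof.
move=> odd_n odd_m [disj_a disj_b disj_ab cover] LE ME M0.
set x := [ffun s => _]; set u := (half n, 0); set w := (0, half m).
have uE k : u *+ k = (half n *+ k, 0).
  by elim: k => // k IH; rewrite !mulrS IH; congr (_, _); rewrite addr0.
have wE k : w *+ k = (0, half m *+ k).
  by elim: k => // k IH; rewrite !mulrS IH; congr (_, _); rewrite addr0.
have fstD (v z : 'I_n.+1 * 'I_m.+1) : (v + z).1 = v.1 + z.1 by [].
have sndD (v z : 'I_n.+1 * 'I_m.+1) : (v + z).2 = v.2 + z.2 by [].
have fstB (v z : 'I_n.+1 * 'I_m.+1) : (v - z).1 = v.1 - z.1 by [].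
have sndB (v z : 'I_n.+1 * 'I_m.+1) : (v - z).2 = v.2 - z.2 by [].
pose y := bip_root (diagonal_graph u w predT x).
have [[k ek]|[l el]] : (exists k, e \in a k) \/ (exists l, e \in b l).
  have := in_setT e; rewrite -cover => /setUP[/bigcupP[k _ ek]|/bigcupP[l _ el]].
    by left; exists k.
  by right; exists l.
- have nb l : e \notin b l.
    by apply: contraL ek => el; have := disj_ab k l;
      rewrite disjoint_sym => /disjointFr->.
  have xE s : x s = (val (k - s.1)%R < n.+2./2)%N.
    rewrite ffunE LE inE (negPf (notin_cyc_block _ _ nb)) orbF.
    by rewrite (mem_cyc_block _ disj_a ek) //; lia.
  have yE v : y v = ~~ x v.
    rewrite xE; have [lt_k|le_k] := boolP (_ < _)%N.
      apply/negbTE/(@diagonal_graph_cycle _ _ _ w _ _ m.+1) => // [i|].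
        by rewrite /diagonal xE wE fstD addr0 lt_k.
      by rewrite wE half_mulrn.
    apply: diagonal_graph_isolated; rewrite xE.
    - rewrite fstD opprD addrA val_sub_half //.
      by move: (k - v.1) le_k => t /=; have := ltn_ord t; case: ifP; lia.
    - rewrite fstB opprD addrA opprK val_add_half //.
      by move: (k - v.1) le_k => t /=; have := ltn_ord t; case: ifP; lia.
    - by rewrite fstD addr0.
    - by rewrite fstB subr0.
  case: j => [v|].
    rewrite /toric_contraction -/y yE ME inE.
    rewrite (negPf (notin_cyc_block _ _ nb)) orbF.
    rewrite (mem_cyc_block _ disj_a ek); last by lia.
    rewrite opprD addrA val_sub_half // xE.
    by move: (k - v.1) => t /=; have := ltn_ord t; case: ifP; lia.
  (* The vertex bits are the complement of [x], so the two counts add up to the odd number of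
     squares and the bit of S_A is 1. *)
  rewrite M0 /toric_contraction -/y.
  have -> : e \in \bigcup_i a i by apply/bigcupP; exists k.
  have -> : #|[pred v | y v]| = #|[predC [pred s | x s]]|.
    by apply: eq_card => v; rewrite !inE yE.
  by rewrite cardC card_prod !card_ord oddM odd_n odd_m.
- have na k : e \notin a k.
    by apply: contraL el => ek; have := disj_ab k l => /disjointFr->.
  have xE s : x s = (val (l - s.2)%R < m./2)%N.
    rewrite ffunE LE inE (negPf (notin_cyc_block _ _ na)) /=.
    by rewrite (mem_cyc_block _ disj_b el) //=; lia.
  have yE v : y v = x v.
    rewrite xE; have [lt_l|le_l] := boolP (_ < _)%N; last first.
      apply/negbTE/(@diagonal_graph_cycle _ _ _ u _ _ n.+1) => // [i|].
        by rewrite /diagonal xE uE sndD addr0 (negPf le_l).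
      by rewrite uE half_mulrn.
    apply: diagonal_graph_isolated; rewrite xE.
    - by rewrite sndD addr0.
    - by rewrite sndB subr0.
    - rewrite sndD opprD addrA val_sub_half //.
      by move: (l - v.2) lt_l => t /=; have := ltn_ord t; case: ifP; lia.
    - rewrite sndB opprD addrA opprK val_add_half //.
      by move: (l - v.2) lt_l => t /=; have := ltn_ord t; case: ifP; lia.
  case: j => [v|].
    rewrite /toric_contraction -/y yE ME inE xE.
    rewrite (negPf (notin_cyc_block _ _ na)) /=.
    by rewrite (mem_cyc_block _ disj_b el) //=; lia.
  (* Here the two counts agree, so the bit of S_A is 0. *)
  rewrite M0 /toric_contraction -/y.
  have -> : #|[pred v | y v]| = #|[pred s | x s]|.
    by apply: eq_card => v; rewrite !inE yE.
  rewrite addnn odd_double; apply/esym/negbTE/bigcupP => -[k _].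
  exact/negP.
Qed.

(** * The toric inequality for graph entropies *)

Lemma eval_allpairs (R : realFieldType) (E I J : finType) (c : R)
    (F : I -> J -> {set E}) (S : {set E} -> R) :
  eval_terms [seq (c, F i j) | i <- enum I, j <- enum J] S =
    \sum_i \sum_j c * S (F i j).
Proof.
rewrite /eval_terms big_allpairs_dep /= big_enum /=.
by apply: eq_bigr => i _; rewrite big_enum.
Qed.

Lemma eval_rcons (R : realFieldType) (E : finType) (ts : seq (R * {set E})) t
    (S : {set E} -> R) :
  eval_terms (rcons ts t) S = eval_terms ts S + t.1 * S t.2.
Proof. by rewrite /eval_terms -cats1 big_cat big_seq1. Qed.

Lemma toric_ineq_graph (R : realFieldType) (E : finType) (alpha beta : nat)
    (a : 'I_alpha -> {set E}) (b : 'I_beta -> {set E}) (G : graph_model R E) :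
    odd alpha -> odd beta -> toric_regions a b ->
  holds_at (toric_ineq R a b) (graph_entropy G).
Proof.
case: alpha a => // n a; case: beta b => // m b odd_n odd_m regions.
rewrite /holds_at /= eval_rcons !eval_allpairs /=.
pose L (s : 'I_n.+1 * 'I_m.+1) := block_plus a s.1 :|: block_minus b s.2.
(* The squares [v - u] and [v + u] have consecutive first indices, and the a-block of the vertex [v]
   starts at the second of them. *)
pose M (j : option ('I_n.+1 * 'I_m.+1)) := if j is Some v then
  block_minus a (v.1 + half n) :|: block_minus b v.2 else \bigcup_i a i.
have boundL e j : toric_contraction ((half n, 0) : 'I_n.+1 * 'I_m.+1) (0, half m)
    [ffun s => e \in L s] j = (e \in M j).
  exact: (toric_contraction_boundary e j odd_n odd_m regions).
have := contraction_entropy G (@toric_contractionP _ _ _) boundL.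
rewrite (bigD1 None) //= (reindex_omap Some id) /= => [|[]] // le_ML.
under eq_bigr do under eq_bigr do rewrite mul1r.
under [X in _ <= X]eq_bigr do under eq_bigr do rewrite mul1r.
rewrite mul1r pair_bigA (pair_bigA _ (fun i j => _ (_ i :|: _ j))) /=.
apply: le_trans le_ML; rewrite [leLHS]addrC lerD2l.
(* This undoes the shift by [half n] in the vertex labels. *)
rewrite (reindex_inj (addIr ((half n, 0) : 'I_n.+1 * 'I_m.+1))) /=.
rewrite [leRHS](eq_bigl xpredT) => [|v]; last exact: eqxx.
by apply: ler_sum => v _; rewrite addr0.
Qed.

(** * Gluing shifted lists into toric instances *)

(** The value 0 on the first list is a normalisation: shifting all lists together would only
    renumber the glued list. *)
Definition offset (n k : nat) (p : {ffun 'I_k -> 'I_n.+1}) (s : 'I_k.+1) :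
    'I_n.+1 :=
  if unlift ord0 s is Some s' then p s' else 0.

Lemma sum_offset (V : nmodType) (n k : nat) (F : {ffun 'I_k.+1 -> 'I_n.+1} -> V) :
  \sum_f F f = \sum_p \sum_i F [ffun s => i + offset p s].
Proof.
rewrite pair_bigA /=; pose h (q : {ffun 'I_k -> 'I_n.+1} * 'I_n.+1) :=
  [ffun s => q.2 + offset q.1 s].
pose h' (f : {ffun 'I_k.+1 -> 'I_n.+1}) :=
  ([ffun s : 'I_k => f (lift ord0 s) - f ord0], f ord0).
rewrite (reindex h) //; exists h' => [[p i]|f] _; rewrite /h /h'.
  have h0 : i + offset p ord0 = i by rewrite /offset unlift_none addr0.
  congr (_, _); last by rewrite ffunE.
  by apply/ffunP => s; rewrite !ffunE h0 /offset liftK addrC addKr.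
apply/ffunP => s; rewrite !ffunE /offset /=.
by case: unliftP => [s' ->|->]; rewrite ?addr0 // ffunE addrC subrK.
Qed.

Definition shifted_union (E : finType) (n k : nat) (a : 'I_n.+1 -> 'I_k.+1 -> E)
    (p : {ffun 'I_k -> 'I_n.+1}) (i : 'I_n.+1) : {set E} :=
  \bigcup_s [set a (i + offset p s) s].

(** The cyclic successor commutes with the shifts; this is why terms of the glued instance are terms
    of the inequality for many lists. *)
Lemma cyc_block_shifted_union (E : finType) (n k : nat)
    (a : 'I_n.+1 -> 'I_k.+1 -> E) p i m :
  cyc_block (shifted_union a p) i m =
  \bigcup_s cyc_block (fun j => [set a j s]) (i + offset p s) m.
Proof.
rewrite /cyc_block /shifted_union exchange_big; apply: eq_bigr => s _.
by apply: eq_bigr => l _; rewrite !iter_ordS addrAC.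
Qed.

Lemma shifted_union_disjoint (E : finType) (n k : nat)
    (a : 'I_n.+1 -> 'I_k.+1 -> E) p i i' :
    (forall i s i' s', a i s = a i' s' -> i = i' /\ s = s') -> i != i' ->
  [disjoint shifted_union a p i & shifted_union a p i'].
Proof.
move=> a_inj; apply: contraNT => /pred0Pn[e /andP[]].
move=> /bigcupP[s _ /set1P->] /bigcupP[s' _ /set1P/a_inj[ii ss]].
by move: ii; rewrite ss => /addIr->.
Qed.

Lemma mem_shifted_union (E : finType) (n k : nat)
    (a : 'I_n.+1 -> 'I_k.+1 -> E) p e :
  reflect (exists i s, e = a i s) (e \in \bigcup_i shifted_union a p i).
Proof.
apply: (iffP bigcupP) => [[i _ /bigcupP[s _ /set1P->]]|[i [s ->]]].
  by exists (i + offset p s), s.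
exists (i - offset p s) => //; apply/bigcupP; exists s => //.
by rewrite subrK set11.
Qed.

Lemma multi_toric_sum (R : realFieldType) (E : finType)
    (alpha beta n_alpha n_beta : nat)
    (n_alpha_ge1 : (1 <= n_alpha)%N) (n_beta_ge1 : (1 <= n_beta)%N)
    (odd_alpha : odd alpha) (odd_beta : odd beta)
    (a : 'I_alpha -> 'I_n_alpha -> E) (b : 'I_beta -> 'I_n_beta -> E)
    (a_distinct : forall i s i' s', a i s = a i' s' -> i = i' /\ s = s')
    (b_distinct : forall j t j' t', b j t = b j' t' -> j = j' /\ t = t')
    (ab_disjoint : forall i s j t, a i s <> b j t)
    (ab_exhaust : forall e : E,
        (exists i s, e = a i s) \/ (exists j t, e = b j t)) :
  sum_of_toric alpha beta (multi_toric_ineq R a b).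
Proof.
case: alpha odd_alpha a a_distinct ab_disjoint ab_exhaust => // n odd_n.
case: n_alpha n_alpha_ge1 => // k _ a a_inj.
case: beta odd_beta b b_distinct => // m odd_m.
case: n_beta n_beta_ge1 => // l _ b b_inj ab cover.
(* One instance per choice of shifts; [k] and [l] are n_alpha - 1 and n_beta - 1. *)
pose K := ({ffun 'I_k -> 'I_n.+1} * {ffun 'I_l -> 'I_m.+1})%type.
pose A (q : K) := shifted_union a q.1; pose B (q : K) := shifted_union b q.2.
exists #|{: K}|, (A \o enum_val), (B \o enum_val); split=> [q|S].
  split.
  - by move=> i i'; apply: shifted_union_disjoint.
  - by move=> i i'; apply: shifted_union_disjoint.
  - move=> i j; apply/pred0Pn => -[e /andP[]].
    by move=> /bigcupP[s _ /set1P->] /bigcupP[t _ /set1P/ab].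
  - apply/setP => e; rewrite !inE; apply/orP.
    by case: (cover e) => ce; [left | right]; apply/mem_shifted_union.
have sum_enum (F : K -> R) :
    \sum_(i < #|{: K}|) F (enum_val i) = \sum_q F q.
  by rewrite (big_enum_val (fun q => F q)).
have regroup (F : {ffun 'I_k.+1 -> 'I_n.+1} -> {ffun 'I_l.+1 -> 'I_m.+1} -> R) :
    \sum_f \sum_g F f g = \sum_(q : K) \sum_i \sum_j
      F [ffun s => i + offset q.1 s] [ffun t => j + offset q.2 t].
  rewrite sum_offset; under eq_bigr do under eq_bigr do rewrite sum_offset.
  rewrite -(pair_bigA _ (fun p r => \sum_i \sum_j
    F [ffun s => i + offset p s] [ffun t => j + offset r t])) /=.
  by apply: eq_bigr => p _; rewrite exchange_big.
(* The block lengths [u] and [v] stay general, to serve both sides of the inequality. *)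
have regroupS u v :
    \sum_(f : {ffun 'I_k.+1 -> 'I_n.+1}) \sum_(g : {ffun 'I_l.+1 -> 'I_m.+1})
      1 * S ((\bigcup_s cyc_block (fun i => [set a i s]) (f s) u)
       :|: (\bigcup_t cyc_block (fun j => [set b j t]) (g t) v)) =
    \sum_(q : K) \sum_i \sum_j 1 * S (cyc_block (A q) i u :|: cyc_block (B q) j v)
    :> R.
  rewrite regroup; apply: eq_bigr => q _; apply: eq_bigr => i _.
  apply: eq_bigr => j _; rewrite !cyc_block_shifted_union.
  by congr (_ * S (_ :|: _)); apply: eq_bigr => s _; rewrite ffunE.
split; rewrite /= ?eval_rcons eval_allpairs.
  rewrite [LHS]regroupS -sum_enum; apply: eq_bigr => q _.
  by rewrite eval_allpairs.
rewrite [X in X + _]regroupS -sum_enum.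
under [RHS]eq_bigr do rewrite eval_rcons eval_allpairs.
rewrite big_split /=; congr (_ + _).
(* The union of all glued regions does not depend on the shifts, so S_A occurs once per instance;
   the size of [K] is its coefficient. *)
have AE (q : K) : \bigcup_i A q i = \bigcup_s \bigcup_i [set a i s].
  apply/setP => e; apply/mem_shifted_union/bigcupP => [[i [s ->]]|].
    by exists s => //; apply/bigcupP; exists i; rewrite ?set11.
  by case=> s _ /bigcupP[i _ /set1P->]; exists i, s.
under [RHS]eq_bigr do rewrite mul1r AE.
rewrite sumr_const card_ord mulr_natl; congr (_ *+ _).
by rewrite card_prod !card_ffun !card_ord.
Qed.

Local Close Scope ring_scope.

Theorem corollary5p1 (R : realFieldType) (E : finType)
    (alpha beta n_alpha n_beta : nat)
    (odd_alpha : odd alpha) (odd_beta : odd beta)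
    (n_alpha_ge1 : 1 <= n_alpha) (n_beta_ge1 : 1 <= n_beta)
    (a : 'I_alpha -> 'I_n_alpha -> E) (b : 'I_beta -> 'I_n_beta -> E)
    (a_distinct : forall i s i' s', a i s = a i' s' -> i = i' /\ s = s')
    (b_distinct : forall j t j' t', b j t = b j' t' -> j = j' /\ t = t')
    (ab_disjoint : forall i s j t, a i s <> b j t)
    (ab_exhaust : forall e : E,
        (exists i s, e = a i s) \/ (exists j t, e = b j t)) :
  is_HEI (multi_toric_ineq R a b) /\
  implied_by_toric alpha beta (multi_toric_ineq R a b) /\
  sum_of_toric alpha beta (multi_toric_ineq R a b).
Proof.
have sum_toric : sum_of_toric alpha beta (multi_toric_ineq R a b).
  exact: multi_toric_sum.
have implied : implied_by_toric alpha beta (multi_toric_ineq R a b).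
  have [N [A [B [regions sumS]]]] := sum_toric.
  move=> S toricS; rewrite /holds_at; have [-> ->] := sumS S.
  by apply: ler_sum => k _; apply: toricS.
split; last by [].
split; last by move=> G; apply: implied => A B; apply: toric_ineq_graph.
rewrite /positive_coefs all_cat all_rcons /= ltr0n muln_gt0 !expn_gt0.
rewrite !odd_gt0 //=; apply/andP; split;
  by apply/allP => _ /allpairsP[[i j] [_ _ ->]] /=; apply: ltr01.
Qed.
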